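(* Let $(\mathcal X,\rho)$ be a complete separable metric space, let $f_1,\dots,f_m:\mathcal X\to\mathcal X$ be Lipschitz maps, and let $(\mu_k)_{k\ge0}$ be probability measures on $\{1,\dots,m\}$ such that, for a constant $e\ge0$, $\sum_{j=1}^m|\mu_k(j)-\mu_{k+1}(j)|\le e$ for all $k>0$. Let $\alpha\in(0,1]$ and let $r\in(0,1)$ be such that $d(P_k^*\nu_1,P_k^*\nu_2)\le r\,d(\nu_1,\nu_2)$ for all $k$ and all Borel probability measures $\nu_1,\nu_2$ on $\mathcal X$. For each $k$ let $\nu_k^*$ be a Borel probability measure on $\mathcal X$ with $P_k^*\nu_k^*=\nu_k^*$, let $\nu_k^0$ be the Borel probability measure on $\mathcal X$ describing the state when $\mu_k$ becomes active, and let $\nu_k^i=P_k^*\nu_k^{i-1}$ for $i\ge1$. Let $t\ge1$ be the number of iterated function applications after each change at $k$, and let $\mathcal G$ be a family of operators on Borel probability measures on $\mathcal X$. Then $$\operatorname{regret}(P_k^* )\le\sum_{k=0}^\infty\left[\frac{2r}{(1-r)^2}\right]d(\nu_k^1,\nu_k^0).$$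
   Context: $P_k^*$ acts on Borel probability measures by $(P_k^*\nu)(A)=\sum_{j=1}^m\mu_k(j)\,\nu(f_j^{-1}(A))$ for Borel sets $A$. With $\mathcal F_\alpha=\{f:\mathcal X\to\mathbb R:\ |f(x)-f(y)|\le\rho(x,y)^\alpha\ \text{for all }x,y\}$, the Wasserstein-type metric is $d(\nu_1,\nu_2)=\sup_{f\in\mathcal F_\alpha}\left[\int f\,d\nu_1-\int f\,d\nu_2\right]$, where the supremum is over those $f\in\mathcal F_\alpha$ integrable with respect to both measures, with values in $[0,\infty]$. No restriction is placed on the measures $\nu_k^0$. The regret is $$\operatorname{regret}(P_k^* )=\sup_{g\in\mathcal G}\left(\sum_{k=0}^\infty\sum_{s=1}^t d(\nu_k^s,\nu_k^* )-\sum_{k=0}^\infty\sum_{s=1}^t d(g\nu_k^s,\nu_k^* )\right),$$ as an element of $[-\infty,\infty]$ (sums of nonnegative terms take values in $[0,\infty]$; a difference $\infty-\infty$ may be assigned any fixed value in $[-\infty,\infty]$). *)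

(* Defs.v *)
From HB Require Import structures.
From mathcomp Require Import all_boot all_order all_algebra.
From mathcomp Require Import all_classical all_reals all_analysis.

Set Implicit Arguments.
Unset Strict Implicit.
Unset Printing Implicit Defensive.

Import Order.TTheory GRing.Theory Num.Theory.
Import numFieldNormedType.Exports.

Local Open Scope classical_set_scope.
Local Open Scope ring_scope.

(* Complete metric spaces. [completeType] is pointed: this is no restriction
   here, since a space carrying a probability measure is nonempty. *)
#[short(type="completeMetricType")]
HB.structure Definition CompleteMetric (R : numDomainType) :=
  {T of Complete T & Metric R T}.

Definition separable (T : topologicalType) : Prop :=
  exists2 D : set T, countable D & dense D.

Notation borel T := (g_sigma_algebraType (@open T)).

Section borel_probability.
Context {R : realType}.

Definition borel_prob (X : completeMetricType R) : Type :=
  probability (borel X) R.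

Definition lipschitz_map (X : completeMetricType R) (f : X -> X) : Prop :=
  exists L : R, forall x y : X, mdist (f x) (f y) <= L * mdist x y.

Definition prob_vector (m : nat) (w : 'I_m -> R) : Prop :=
  (forall j, 0 <= w j) /\ \sum_(j < m) w j = 1.

Lemma lipschitz_map_continuous (X : completeMetricType R) (f : X -> X) :
  lipschitz_map f -> continuous f.
Proof.
move=> [L fL] x.
apply/metricType_numDomainType.cvgrPdist_lt => e e0.
have M0 : 0 < `|L| + 1 by rewrite ltr_wpDl.
have : \forall y \near x, mdist x y < e / (`|L| + 1).
  apply: metricType_numDomainType.cvgr_dist_lt; first exact: cvg_id.
  exact: divr_gt0.
apply: filterS => y; rewrite ltr_pdivlMr // => xy.
apply: le_lt_trans xy; apply: le_trans (fL x y) _.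
rewrite mulrC ler_wpM2l ?mdist_ge0 //.
by rewrite (le_trans (ler_norm _)) // lerDl.
Qed.

Lemma lipschitz_map_measurable (X : completeMetricType R) (f : X -> X) :
  lipschitz_map f -> measurable_fun [set: borel X] (f : borel X -> borel X).
Proof.
move=> /lipschitz_map_continuous/continuousP fc.
apply: (measurability (@open X : set (set (borel X)))) => //= _ [B oB <-].
by rewrite setTI; apply: sub_gen_smallest; exact: fc.
Qed.

End borel_probability.

Section markov_dual.
Local Open Scope ereal_scope.
Context {R : realType} {X : completeMetricType R} {m : nat}.
Context {f : 'I_m -> X -> X} {w : 'I_m -> R}.

(* The proofs [hf] and [hw] do not occur in the formula; they are arguments so
   that the value is canonically a probability measure. *)
Definition markov_dual_fun (hf : forall j, lipschitz_map (f j))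
    (hw : prob_vector w) (nu : borel_prob X) : set (borel X) -> \bar R :=
  fun A => \sum_(j < m) (w j)%:E * nu (f j @^-1` A).

Variables (hf : forall j, lipschitz_map (f j)) (hw : prob_vector w).
Variable nu : borel_prob X.

Local Notation P := (markov_dual_fun hf hw nu).

Let measurable_preimage j (A : set (borel X)) :
  measurable A -> measurable (f j @^-1` A : set (borel X)).
Proof.
by move=> mA; rewrite -[X in measurable X]setTI;
   exact: (lipschitz_map_measurable (hf j)).
Qed.

Let P0 : P set0 = 0.
Proof.
by rewrite /markov_dual_fun big1 // => j _; rewrite preimage_set0 measure0 mule0.
Qed.

Let P_ge0 A : 0 <= P A.
Proof.
by apply: sume_ge0 => j _; rewrite mule_ge0 // lee_fin; case: hw.
Qed.

Let P_sigma_additive : semi_sigma_additive P.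
Proof.
move=> F mF tF mUF; rewrite /markov_dual_fun.
rewrite [X in X @ _ --> _](_ : _ = (fun n =>
    \sum_(j < m) (w j)%:E * \sum_(0 <= i < n) nu (f j @^-1` F i))); last first.
  apply/funext => n; rewrite exchange_big /=; apply: eq_bigr => j _.
  by rewrite ge0_sume_distrr.
apply: cvg_nnesum => [j _|j _].
  near=> n; apply: mule_ge0; first by rewrite lee_fin; case: hw.
  by apply: sume_ge0.
apply: cvgeZl => //; rewrite preimage_bigcup.
apply: measure_semi_sigma_additive.
- by move=> n; exact: measurable_preimage.
- apply/trivIsetP => /= a b _ _ ab; rewrite -preimage_setI.
  by move/trivIsetP : tF => /(_ _ _ _ _ ab) ->//; rewrite preimage_set0.
- by rewrite -preimage_bigcup; exact: measurable_preimage.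
Unshelve. all: by end_near. Qed.

HB.instance Definition _ := isMeasure.Build _ _ _ P P0 P_ge0 P_sigma_additive.

Let P_setT : P [set: borel X] = 1.
Proof.
rewrite /markov_dual_fun; under eq_bigr do
  rewrite preimage_setT probability_setT mule1.
by rewrite sumEFin; case: hw => _ ->.
Qed.

HB.instance Definition _ := Measure_isProbability.Build _ _ _ P P_setT.

Definition markov_dual : borel_prob X := P.

End markov_dual.

Section regret.
Local Open Scope ereal_scope.
Context {R : realType} {X : completeMetricType R}.

Definition holder1 (alpha : R) : set (X -> R) :=
  [set h | forall x y : X, (`|h x - h y| <= mdist x y `^ alpha)%R].

Definition wdist (alpha : R) (nu1 nu2 : borel_prob X) : \bar R :=
  ereal_sup [set \int[nu1]_x (h x)%:E - \int[nu2]_x (h x)%:E | h in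
    [set h : borel X -> R | [/\ holder1 alpha h,
      nu1.-integrable [set: borel X] (EFin \o h) &
      nu2.-integrable [set: borel X] (EFin \o h)]]].

(* [c] is the value assigned to the otherwise undefined [+oo - +oo]. *)
Definition esub (c x y : \bar R) : \bar R :=
  if (x == +oo) && (y == +oo) then c else x - y.

Definition regret (c : \bar R) (alpha : R) (t : nat)
    (G : set (borel_prob X -> borel_prob X))
    (nu : nat -> nat -> borel_prob X) (nustar : nat -> borel_prob X) : \bar R :=
  ereal_sup [set
    esub c
      (\sum_(0 <= k <oo) \sum_(1 <= s < t.+1)
         wdist alpha (nu k s) (nustar k))
      (\sum_(0 <= k <oo) \sum_(1 <= s < t.+1)
         wdist alpha (g (nu k s)) (nustar k))
  | g in G].

End regret.

(* Main.v *)
Require Import Defs.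
From HB Require Import structures.
From mathcomp Require Import all_boot all_order all_algebra.
From mathcomp Require Import all_classical all_reals all_analysis.
From mathcomp Require Import measurable_realfun giry lra.

Import Order.TTheory GRing.Theory Num.Theory.
Import numFieldNormedType.Exports.

Local Open Scope classical_set_scope.
Local Open Scope ring_scope.
Local Open Scope ereal_scope.

(** Subtracting the (nonnegative) cost of a competitor [g] only decreases the
regret, so it suffices to bound, for each [k], the total distance
[d(nu^1, eta) + ... + d(nu^t, eta)] of an orbit of the contraction [P] to its
invariant measure [eta]. Invariance and contraction give
[d(nu^s, eta) <= r^s d(nu^0, eta)], hence a total of at most
[r / (1 - r) * d(nu^0, eta)], and the remaining point is the estimate
[d(nu, eta) <= d(P nu, nu) / (1 - r)] of [wdist_invariant_le]. Together they
bound the total by [r / (1 - r)^2 * d(P nu^0, nu^0)].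

For a metric taking finite values the last estimate is just the triangle
inequality. Here [d] may be infinite, and a priori [nu] could lie at a finite
distance from [P nu] but at infinite distance from [eta]. The proof therefore
works on the dual side. A truncation argument shows that the supremum defining
[d] may be taken over bounded Holder functions ([wdist_leP]), which are
integrable for every probability measure. Let [Q h = \sum_j w_j (h \o f_j)] be
the operator dual to [P]. For [h] bounded and Holder with constant 1,
telescoping gives
  [E_nu h - E_eta h = \sum_(i < n) (E_nu (Q^i h) - E_(P nu) (Q^i h))
                      + (E_nu (Q^n h) - E_eta (Q^n h))].
Testing the contraction on Dirac masses shows that [Q^i h] is Holder with
constant [r^i] ([markov_op_holder]); hence the sum is at most
[\sum_i r^i d(P nu, nu)], whether or not [d(nu, eta)] is finite. The
functions [Q^n h] are uniformly bounded and their oscillation between any two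
points tends to 0, so the remainder vanishes in the limit by dominated
convergence ([cvg_expect_iter]). *)

(** * Bounded Holder functions *)

Section bounded_holder.
Set Implicit Arguments.
Unset Strict Implicit.
Context {R : realType} {X : completeMetricType R}.
Implicit Types (nu : borel_prob X) (h : X -> R) (alpha K : R).

Definition expect nu h : R := (\int[nu]_(x in [set: borel X]) h x)%R.

(** The exponent is fixed while the constant varies, because the dual operator
multiplies the constant by [r]. Boundedness gives integrability for every
probability measure, so that differences of expectations can be added and
telescoped freely. *)
Definition bounded_holder alpha K h : Prop :=
  (forall x y, (`|h x - h y| <= K * mdist x y `^ alpha)%R) /\
  exists M, forall x, (`|h x| <= M)%R.

Lemma holder_continuous alpha K h : (0 < alpha)%R -> (0 < K)%R ->
  (forall x y, (`|h x - h y| <= K * mdist x y `^ alpha)%R) -> continuous h.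
Proof.
move=> a0 K0 hh x; apply/cvgrPdist_lt => e e0.
have eK0 : (0 < e / K)%R by exact: divr_gt0.
have : \forall y \near x, (mdist x y < (e / K) `^ (alpha^-1))%R.
  apply: metricType_numDomainType.cvgr_dist_lt; first exact: cvg_id.
  exact: powR_gt0.
apply: filterS => y xy; apply: le_lt_trans (hh x y) _.
rewrite mulrC -ltr_pdivlMr//.
have -> : (e / K = ((e / K) `^ alpha^-1) `^ alpha)%R.
  by rewrite -powRrM mulVf ?gt_eqF// powRr1 ?ltW.
by rewrite gt0_ltr_powR// nnegrE ?mdist_ge0 ?powR_ge0.
Qed.

Lemma holder_measurable alpha K h : (0 < alpha)%R -> (0 < K)%R ->
  (forall x y, (`|h x - h y| <= K * mdist x y `^ alpha)%R) ->
  measurable_fun [set: borel X] (h : borel X -> R).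
Proof.
move=> a0 K0 /(holder_continuous a0 K0) /continuousP hc.
apply: (measurability _ (RGenOInfty.measurableE R)) => //= _ [B [a ->] <-].
by rewrite setTI; apply: sub_gen_smallest; apply: hc; exact: interval_open.
Qed.

Lemma bounded_measurable_integrable nu h M :
  measurable_fun [set: borel X] (h : borel X -> R) ->
  (forall x, (`|h x| <= M)%R) ->
  nu.-integrable [set: borel X] (EFin \o h).
Proof.
move=> mh hM; apply: measurable_bounded_integrable => //.
  by rewrite ltey_eq fin_num_measure.
by exists M; split => [|N MN]; rewrite ?num_real//= => x _; apply: le_trans (hM x) (ltW MN).
Qed.

Lemma bounded_holder_integrable nu alpha K h :
  (0 < alpha)%R -> (0 < K)%R -> bounded_holder alpha K h ->
  nu.-integrable [set: borel X] (EFin \o h).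
Proof.
move=> a0 K0 [hh [M hM]]; apply: bounded_measurable_integrable hM.
exact: holder_measurable hh.
Qed.

Lemma expectE nu h : nu.-integrable [set: borel X] (EFin \o h) ->
  (expect nu h)%:E = \int[nu]_(x in [set: borel X]) (h x)%:E.
Proof. by move=> ih; rewrite /expect /Rintegral fineK//; exact: integrable_fin_num. Qed.

Lemma expect_measure_eq nu1 nu2 h : measure_eq nu1 nu2 -> expect nu1 h = expect nu2 h.
Proof.
by move=> e; congr fine; apply: eq_measure_integral => A mA _; exact: e.
Qed.

Lemma expect_dirac (x : X) alpha K h :
  (0 < alpha)%R -> (0 < K)%R -> bounded_holder alpha K h ->
  expect (@dirac _ (borel X) x R) h = h x.
Proof.
move=> a0 K0 [hh _].
rewrite /expect /Rintegral integral_dirac// ?diracT ?mul1e//.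
apply/measurable_EFinP; exact: holder_measurable hh.
Qed.

Lemma bounded_holderZ alpha K c h : bounded_holder alpha K h ->
  bounded_holder alpha (`|c| * K)%R (fun x => c * h x)%R.
Proof.
move=> [hh [M hM]]; split=> [x y|].
  by rewrite -mulrBr normrM -mulrA ler_wpM2l.
by exists (`|c| * M)%R => x; rewrite normrM ler_wpM2l.
Qed.

Definition truncate (M a : R) : R := Num.max (- M)%R (Num.min a M).

Lemma truncate_lipschitz M a b : (`|truncate M a - truncate M b| <= `|a - b|)%R.
Proof.
rewrite /truncate ler_norml.
have ab := ler_norm (a - b)%R; have := ler_norm (b - a)%R; rewrite (distrC b) => ba.
by case: (leP a M) => ?; case: (leP b M) => ?;
   do ![case: (leP (- M)%R) => ?]; lra.
Qed.

Lemma truncate_bounded M a : (0 <= M)%R -> (`|truncate M a| <= M)%R.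
Proof.
move=> M0; rewrite /truncate ler_norml.
case: (leP a M) => aM; last by rewrite max_r; lra.
by case: (leP (- M)%R a) => ?; lra.
Qed.

Lemma truncate_id M a : (`|a| <= M)%R -> truncate M a = a.
Proof.
rewrite ler_norml => /andP[Ma aM].
by rewrite /truncate min_l// max_r.
Qed.

Lemma truncate_le M a : (0 <= M)%R -> (`|truncate M a| <= `|a|)%R.
Proof.
move=> M0; have := truncate_lipschitz M a 0%R.
by rewrite (@truncate_id M 0%R) ?normr0// !subr0.
Qed.

(** The truncations of [h] are dominated by [`|h|] and agree with [h] at each
point from some rank on. *)
Lemma cvg_integral_truncate nu h : nu.-integrable [set: borel X] (EFin \o h) ->
  \int[nu]_(x in [set: borel X]) (truncate n%:R (h x))%:E @[n --> \oo] -->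
  \int[nu]_(x in [set: borel X]) (h x)%:E.
Proof.
move=> ih; have /integrableP[/measurable_EFinP mh _] := ih.
have [] := @dominated_convergence _ (borel X) R nu setT measurableT
  (fun n x => (truncate n%:R (h x))%:E) (EFin \o h) (abse \o (EFin \o h)).
- move=> n; apply/measurable_EFinP; apply: measurable_maxr => //.
  exact: measurable_minr.
- exact/measurable_EFinP.
- apply: aeW => x _; apply: cvg_near_cst.
  have hn := archi_boundP (normr_ge0 (h x)).
  near=> k; congr EFin; apply: truncate_id.
  by apply: le_trans (ltW hn) _; rewrite ler_nat; near: k; exact: nbhs_infty_ge.
- exact: integrable_abse.
- by apply: aeW => x n _ /=; rewrite lee_fin truncate_le.
- by move=> _ _.
Unshelve. all: by end_near. Qed.

End bounded_holder.

(** * The Wasserstein-type distance *)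

Section wdist_bounded.
Set Implicit Arguments.
Unset Strict Implicit.
Context {R : realType} {X : completeMetricType R} {alpha : R}.
Hypothesis alpha_gt0 : (0 < alpha)%R.
Implicit Types (nu : borel_prob X) (h : X -> R) (K : R).

Lemma le_wdist_bounded nu1 nu2 h : bounded_holder alpha 1 h ->
  (expect nu1 h - expect nu2 h)%:E <= wdist alpha nu1 nu2.
Proof.
move=> hh; have ih nu := bounded_holder_integrable nu alpha_gt0 ltr01 hh.
rewrite EFinB !expectE//; apply: ereal_sup_ubound; exists h => //; split => //.
by case: hh => hh _ x y; rewrite -[leRHS]mul1r.
Qed.

(** Truncation preserves the Holder bound, so an integrable test function can be
replaced by its truncations, whose integrals converge to that of the function
for both measures. *)
Lemma wdist_leP nu1 nu2 B :
  (forall h, bounded_holder alpha 1 h ->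
     (expect nu1 h - expect nu2 h)%:E <= B) ->
  wdist alpha nu1 nu2 <= B.
Proof.
move=> hB; apply: ub_ereal_sup => _ [h [hh i1 i2] <-].
pose hn n x := truncate n%:R (h x).
have bhn n : bounded_holder alpha 1 (hn n).
  split=> [x y|]; first by rewrite mul1r (le_trans (truncate_lipschitz _ _ _)).
  by exists n%:R => x; exact: truncate_bounded.
have cvgh : \int[nu1]_(x in [set: borel X]) (hn n x)%:E
    - \int[nu2]_(x in [set: borel X]) (hn n x)%:E @[n --> \oo] -->
    \int[nu1]_(x in [set: borel X]) (h x)%:E
    - \int[nu2]_(x in [set: borel X]) (h x)%:E.
  apply: cvgeB; [|exact: cvg_integral_truncate..].
  by apply: fin_num_adde_defl; rewrite fin_numN; exact: integrable_fin_num.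
rewrite -(cvg_lim _ cvgh)//; apply: lime_le; first exact/cvgP/cvgh.
apply: nearW => n; have ihn nu := bounded_holder_integrable nu alpha_gt0 ltr01 (bhn n).
by rewrite -!expectE// -EFinB; exact: hB.
Qed.

Lemma expectZ nu K c h : (0 < K)%R -> bounded_holder alpha K h ->
  expect nu (fun x => c * h x)%R = (c * expect nu h)%R.
Proof.
move=> K0 hh; rewrite /expect RintegralZl//.
exact: (bounded_holder_integrable nu alpha_gt0 K0 hh).
Qed.

(** Homogeneity: a function of Holder constant [K] is [K] times an admissible test
function. *)
Lemma le_wdist_holder nu1 nu2 K h : (0 < K)%R -> bounded_holder alpha K h ->
  (expect nu1 h - expect nu2 h)%:E <= K%:E * wdist alpha nu1 nu2.
Proof.
move=> K0 hh; rewrite -lee_pdivrMl//.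
have := le_wdist_bounded nu1 nu2 (h := fun x => (K^-1 * h x)%R).
rewrite !(expectZ _ _ K0 hh) -mulrBr EFinM; apply.
have := bounded_holderZ (K^-1)%R hh.
by rewrite ger0_norm ?invr_ge0 ?ltW// mulVf ?gt_eqF.
Qed.

Lemma wdist_ge0 nu1 nu2 : 0 <= wdist alpha nu1 nu2.
Proof.
have := @le_wdist_bounded nu1 nu2 (fun=> 0%R).
rewrite /expect !Rintegral_cst// !mul0r subrr; apply; split=> [x y|].
  by rewrite subrr normr0 mul1r powR_ge0.
by exists 0%R => x; rewrite normr0.
Qed.

(** The class of bounded Holder functions is stable under [h |-> - h]; this plays
the role of the symmetry of the distance. *)
Lemma le_wdist_holder_sym nu1 nu2 K h : (0 < K)%R -> bounded_holder alpha K h ->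
  (expect nu2 h - expect nu1 h)%:E <= K%:E * wdist alpha nu1 nu2.
Proof.
move=> K0 hh; have := @le_wdist_holder nu1 nu2 K (fun x => -1 * h x)%R K0.
rewrite !(expectZ _ _ K0 hh) -mulrBr mulN1r opprB; apply.
by have := bounded_holderZ (-1)%R hh; rewrite normrN1 mul1r.
Qed.

(** Transport along [measure_eq] is needed because orbits and invariant measures
are only determined on measurable sets. *)
Lemma wdist_measure_eq nu1 nu1' nu2 nu2' : measure_eq nu1 nu1' ->
  measure_eq nu2 nu2' -> wdist alpha nu1 nu2 <= wdist alpha nu1' nu2'.
Proof.
move=> e1 e2; apply: wdist_leP => h hh.
by rewrite (expect_measure_eq h e1) (expect_measure_eq h e2) le_wdist_bounded.
Qed.

Lemma wdist_dirac x y :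
  wdist alpha (@dirac _ (borel X) x R) (@dirac _ (borel X) y R)
  <= (mdist x y `^ alpha)%:E.
Proof.
apply: wdist_leP => h hh; rewrite !(expect_dirac _ alpha_gt0 ltr01 hh) lee_fin.
by rewrite (le_trans (ler_norm _))//; case: hh => + _ => /(_ x y); rewrite mul1r.
Qed.

End wdist_bounded.

(** * The dual operator *)

Section markov_op.
Set Implicit Arguments.
Unset Strict Implicit.
Context {R : realType} {X : completeMetricType R} {m : nat}.
Context {f : 'I_m -> X -> X} {w : 'I_m -> R}.
Hypothesis hf : forall j, lipschitz_map (f j).
Hypothesis hw : prob_vector w.
Implicit Types (nu : borel_prob X) (h : X -> R).

Definition markov_op h : X -> R := fun x => (\sum_(j < m) w j * h (f j x))%R.

Lemma markov_op_cst (c : R) : markov_op (fun=> c) = fun=> c.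
Proof. by apply/funext => x; rewrite /markov_op -mulr_suml hw.2 mul1r. Qed.

Lemma markov_op_norm_le h M : (forall x, (`|h x| <= M)%R) ->
  forall x, (`|markov_op h x| <= M)%R.
Proof.
move=> hM x; apply: le_trans (ler_norm_sum _ _ _) _.
rewrite -[leRHS](congr1 (@^~ x) (markov_op_cst M)).
by apply: ler_sum => j _; rewrite normrM ger0_norm ?hw.1// ler_wpM2l// hw.1.
Qed.

Lemma markov_op_measurable h : measurable_fun [set: borel X] (h : borel X -> R) ->
  measurable_fun [set: borel X] (markov_op h : borel X -> R).
Proof.
move=> mh; apply: (measurable_sum _ (h := fun j (x : borel X) => (w j * h (f j x))%R)) => j.
apply: measurable_funM => //.
exact: measurableT_comp mh (lipschitz_map_measurable (hf j)).
Qed.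

(** [markov_dual hf hw nu] is the finite sum of the images of [nu] under the
[f j], scaled by [w j]. *)
Lemma ge0_integral_markov_dual nu h :
  measurable_fun [set: borel X] (h : borel X -> R) -> (forall x, (0 <= h x)%R) ->
  \int[markov_dual hf hw nu]_(x in [set: borel X]) (h x)%:E =
  \int[nu]_(x in [set: borel X]) (markov_op h x)%:E.
Proof.
move=> mh h0.
have mf j : measurable_fun [set: borel X] (f j : borel X -> borel X).
  exact: lipschitz_map_measurable.
have mhE : measurable_fun [set: borel X] (fun x : borel X => (h x)%:E).
  exact/measurable_EFinP.
pose fM j : {mfun borel X >-> borel X} :=
  HB.pack (f j : borel X -> borel X) (isMeasurableFun.Build _ _ _ _ _ (mf j)).
pose term j : {measure set (borel X) -> \bar R} :=
  mscale (NngNum (hw.1 j)) (distribution nu (fM j)).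
(* sums of measures are indexed by natural numbers, hence the extension of the
   family over the ordinals by the zero measure *)
pose mm n : {measure set (borel X) -> \bar R} :=
  oapp term mzero (insub n).
have mmE (j : 'I_m) : mm j = term j by rewrite /mm valK.
rewrite (eq_measure_integral (msum mm m)); last first.
  move=> A mA _; rewrite /= /markov_dual_fun /msum.
  by apply: eq_bigr => j _; rewrite mmE.
rewrite ge0_integral_measure_sum//; last by move=> x _; rewrite lee_fin.
transitivity (\sum_(j < m) \int[nu]_(x in [set: borel X]) (w j * h (f j x))%:E).
  apply: eq_bigr => j _; rewrite mmE ge0_integral_mscale//.
  - rewrite ge0_integral_distribution//=.
    under [RHS]eq_integral do rewrite EFinM.
    rewrite ge0_integralZl_EFin ?hw.1//.
    + by move=> x _; rewrite lee_fin.
    + exact: measurableT_comp mhE (mf j).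
  - by move=> x _; rewrite lee_fin.
rewrite -ge0_integral_sum//.
- by apply: eq_integral => x _; rewrite sumEFin.
- move=> j; apply/measurable_EFinP; apply: measurable_funM => //.
  exact: measurableT_comp mh (mf j).
- by move=> j x _; rewrite lee_fin mulr_ge0 ?hw.1.
Qed.

(** Constants are fixed by [markov_op] and have the same integral against both
probability measures, so adding the bound [M] to [h] reduces the duality to nonnegative functions. *)
Lemma expect_markov_dual nu h M :
  measurable_fun [set: borel X] (h : borel X -> R) -> (forall x, (`|h x| <= M)%R) ->
  expect (markov_dual hf hw nu) h = expect nu (markov_op h).
Proof.
move=> mh hM.
have ih nu' := bounded_measurable_integrable nu' mh hM.
have iQh nu' := bounded_measurable_integrable nu'
  (markov_op_measurable mh) (markov_op_norm_le hM).
have ic nu' : nu'.-integrable [set: borel X] (EFin \o cst M).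
  exact: finite_measure_integrable_cst.
have := @ge0_integral_markov_dual nu (fun x => h x + M)%R.
have -> : markov_op (fun x => h x + M)%R = (fun x => markov_op h x + M)%R.
  apply/funext => x; rewrite -[X in _ = (_ + X)%R](congr1 (@^~ x) (markov_op_cst M)).
  by rewrite /markov_op -big_split; apply: eq_bigr => j _; rewrite mulrDr.
move=> H; apply: (@addIr _ M); rewrite -[M in LHS]mulr1 -[M in RHS]mulr1.
have PM nu' : (M * 1 = \int[nu']_(x in [set: borel X]) M)%R.
  by rewrite Rintegral_cst// [X in fine X](probability_setT nu').
rewrite [in LHS](PM (markov_dual hf hw nu)) [in RHS](PM nu) /expect -!RintegralD//;
  [|exact: iQh|exact: ic|exact: ih|exact: ic].
congr fine; apply: H; first exact: measurable_funD.
by move=> x; move: (hM x); rewrite ler_norml; lra.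
Qed.

End markov_op.

(** * Contraction and distance to an invariant measure *)

Section contraction.
Set Implicit Arguments.
Unset Strict Implicit.
Context {R : realType} {X : completeMetricType R} {m : nat}.
Context {f : 'I_m -> X -> X} {w : 'I_m -> R} {alpha r : R}.
Hypotheses (alpha_gt0 : (0 < alpha)%R) (r_gt0 : (0 < r)%R) (r_lt1 : (r < 1)%R).
Variables (hf : forall j, lipschitz_map (f j)) (hw : prob_vector w).
Local Notation P := (markov_dual hf hw).
Local Notation Q := (@markov_op R X m f w).
Hypothesis P_contract : forall nu1 nu2 : borel_prob X,
  wdist alpha (P nu1) (P nu2) <= r%:E * wdist alpha nu1 nu2.
Implicit Types (nu eta : borel_prob X) (h : X -> R).

Lemma expect_markov_dual_holder nu K h : (0 < K)%R -> bounded_holder alpha K h ->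
  expect (P nu) h = expect nu (Q h).
Proof.
move=> K0 [hh [M hM]]; apply: expect_markov_dual hM.
exact: holder_measurable hh.
Qed.

(** [Q h x] is the expectation of [h] under the image by [P] of the Dirac mass at
[x], and the distance between the Dirac masses at [x] and [y] is at most
[mdist x y `^ alpha]. *)
Lemma markov_op_holder K h : (0 < K)%R -> bounded_holder alpha K h ->
  bounded_holder alpha (r * K) (Q h).
Proof.
move=> K0 hh; have [hh1 [M hM]] := hh.
split; last by exists M; exact: markov_op_norm_le.
have mQh : measurable_fun [set: borel X] (Q h : borel X -> R).
  by apply: markov_op_measurable => //; exact: holder_measurable hh1.
have QE z : expect (P (@dirac _ (borel X) z R)) h = Q h z.
  rewrite (expect_markov_dual_holder _ K0 hh) /expect /Rintegral.
  by rewrite integral_dirac ?diracT ?mul1e//; exact/measurable_EFinP.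
have le x y : (Q h x - Q h y <= r * K * mdist x y `^ alpha)%R.
  rewrite -lee_fin -!QE; apply: le_trans (le_wdist_holder alpha_gt0 _ _ K0 hh) _.
  rewrite mulrAC mulrC EFinM lee_pmul2l//; apply: le_trans (P_contract _ _) _.
  by rewrite EFinM lee_pmul2l//; exact: wdist_dirac.
move=> x y; rewrite ler_norml le //= lerNl opprB andbT.
by rewrite metric_sym le.
Qed.

Lemma iter_markov_op_holder K h n : (0 < K)%R -> bounded_holder alpha K h ->
  bounded_holder alpha (r ^+ n * K) (iter n Q h).
Proof.
move=> K0 hh; elim: n => [|n IHn]; first by rewrite expr0 mul1r.
by rewrite exprS -mulrA; apply: markov_op_holder => //; rewrite mulr_gt0// exprn_gt0.
Qed.

Lemma iter_markov_op_norm_le h M n : (forall x, (`|h x| <= M)%R) ->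
  forall x, (`|iter n Q h x| <= M)%R.
Proof. by move=> hM; elim: n => // n IHn; exact: markov_op_norm_le. Qed.

(** [Q^n h - Q^n h x0] is bounded uniformly in [n] and is at most
[r^n K mdist x x0 `^ alpha] at [x]. The second bound gives the
pointwise limit 0; it need not be integrable in [x], and the first one is what
dominates. *)
Lemma cvg_expect_iter nu x0 K h : (0 < K)%R -> bounded_holder alpha K h ->
  (expect nu (iter n Q h) - iter n Q h x0)%R @[n --> \oo] --> 0%R.
Proof.
move=> K0 hh; have [_ [M hM]] := hh.
have Kn n : (0 < r ^+ n * K)%R by rewrite mulr_gt0// exprn_gt0.
have Qn n := iter_markov_op_holder n K0 hh.
have iQ n nu' := bounded_holder_integrable nu' alpha_gt0 (Kn n) (Qn n).
have ic (c : R) nu' : nu'.-integrable [set: borel X] (EFin \o cst c).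
  exact: finite_measure_integrable_cst.
pose u n x := (iter n Q h x - iter n Q h x0)%R.
have -> : (fun n => expect nu (iter n Q h) - iter n Q h x0)%R =
    fine \o (fun n => \int[nu]_(x in [set: borel X]) (u n x)%:E).
  apply/funext => n /=.
  rewrite -[RHS]/(\int[nu]_(x in [set: borel X]) u n x)%R.
  rewrite RintegralB//; [|exact: iQ|exact: ic].
  by rewrite Rintegral_cst// [X in fine X](probability_setT nu) mulr1.
apply: fine_cvg.
have [] := @dominated_convergence _ (borel X) R nu setT measurableT
  (fun n x => (u n x)%:E) (cst 0) (cst (M + M)%:E).
- move=> n; apply/measurable_EFinP; apply: measurable_funB => //.
  exact: holder_measurable (Qn n).1.
- exact: measurable_cst.
- apply: aeW => x _; apply/cvg_EFin; first exact: nearW.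
  apply: (@squeeze_cvgr _ _ _ _ (fun n => - (K * mdist x x0 `^ alpha * r ^+ n))%R
     (fun n => (K * mdist x x0 `^ alpha * r ^+ n))%R).
  + apply: nearW => n; rewrite -ler_norml.
    by rewrite mulrC mulrA; exact: (Qn n).1.
  + rewrite -oppr0; apply: cvgN; apply: cvg_geometric.
    by rewrite ger0_norm ?ltW.
  + by apply: cvg_geometric; rewrite ger0_norm ?ltW.
- exact: ic.
- apply: aeW => x n _; rewrite lee_fin.
  by apply: le_trans (ler_normB _ _) _; apply: lerD; exact: iter_markov_op_norm_le.
- by move=> _ _; rewrite integral0.
Qed.

(** At each step [E_nu (Q^n h)] is compared with [E_(P nu) (Q^n h)], which is
[E_nu (Q^(n + 1) h)], whereas [eta] does not distinguish [Q^n h] from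
[Q^(n + 1) h]. *)
Lemma expect_telescope nu eta K h n : measure_eq (P eta) eta ->
  wdist alpha (P nu) nu \is a fin_num -> (0 < K)%R -> bounded_holder alpha K h ->
  (expect nu h - expect eta h <=
   series (geometric (fine (wdist alpha (P nu) nu) * K) r) n +
   (expect nu (iter n Q h) - expect eta (iter n Q h)))%R.
Proof.
move=> inv fD K0 hh; elim: n => [|n IHn].
  by rewrite /series/= big_geq// add0r.
apply: le_trans IHn _.
have Kn : (0 < r ^+ n * K)%R by rewrite mulr_gt0// exprn_gt0.
have Qn := iter_markov_op_holder n K0 hh.
rewrite seriesSr -addrA lerD2l.
have := le_wdist_holder_sym alpha_gt0 (P nu) nu Kn Qn.
rewrite -(fineK fD) -EFinM lee_fin.
rewrite -(expect_measure_eq _ inv) !(expect_markov_dual_holder _ Kn Qn).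
by rewrite /geometric/=; lra.
Qed.

(** This is the a priori bound of Banach's fixed point theorem. It also holds
when [wdist alpha nu eta] is not known to be finite, where the triangle
inequality would be of no help. *)
Lemma wdist_invariant_le nu eta : measure_eq (P eta) eta ->
  wdist alpha nu eta <= (1 - r)^-1%:E * wdist alpha (P nu) nu.
Proof.
move=> inv.
have r1 : (0 < 1 - r)%R by rewrite subr_gt0.
have D0 : 0 <= wdist alpha (P nu) nu by exact: wdist_ge0.
have [fD|] := boolP (wdist alpha (P nu) nu \is a fin_num); last first.
  rewrite ge0_fin_numE// -leNgt leye_eq => /eqP ->.
  by rewrite gt0_muley ?leey// lte_fin invr_gt0.
apply: wdist_leP => // h hh.
rewrite -(fineK fD) -EFinM lee_fin mulrC.
have cvg : (fine (wdist alpha (P nu) nu) * 1 / (1 - r) +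
   (expect nu (iter n Q h) - expect eta (iter n Q h)))%R @[n --> \oo] -->
   (fine (wdist alpha (P nu) nu) / (1 - r))%R.
  rewrite mulr1 -[X in _ --> X]addr0; apply: cvgD; first exact: cvg_cst.
  rewrite (_ : (fun n => _) = (fun n =>
      (expect nu (iter n Q h) - iter n Q h point) -
      (expect eta (iter n Q h) - iter n Q h point))%R); last first.
    by apply/funext => n; rewrite opprB addrA subrK.
  by rewrite -[X in _ --> X](subr0 0%R); apply: cvgB; exact: cvg_expect_iter ltr01 hh.
apply: (cvgr_to_ge cvg); apply: nearW => n.
apply: le_trans (expect_telescope n inv fD ltr01 hh) _; rewrite lerD2r.
apply: geometric_le_lim => //; last by rewrite ger0_norm ?ltW.
by rewrite mulr1 fine_ge0.
Qed.

End contraction.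

(** * Orbits *)

Section orbit.
Set Implicit Arguments.
Unset Strict Implicit.
Context {R : realType} {X : completeMetricType R} {m : nat}.
Context {f : 'I_m -> X -> X} {w : 'I_m -> R} {alpha r : R}.
Hypotheses (alpha_gt0 : (0 < alpha)%R) (r_gt0 : (0 < r)%R) (r_lt1 : (r < 1)%R).
Variables (hf : forall j, lipschitz_map (f j)) (hw : prob_vector w).
Local Notation P := (markov_dual hf hw).
Hypothesis P_contract : forall nu1 nu2 : borel_prob X,
  wdist alpha (P nu1) (P nu2) <= r%:E * wdist alpha nu1 nu2.
Variables (nu : nat -> borel_prob X) (eta : borel_prob X).
Hypothesis nu_step : forall i, measure_eq (nu i.+1) (P (nu i)).
Hypothesis eta_inv : measure_eq (P eta) eta.

Lemma measure_eq_sym (nu1 nu2 : borel_prob X) :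
  measure_eq nu1 nu2 -> measure_eq nu2 nu1.
Proof. by move=> e A mA; rewrite e. Qed.

Lemma wdist_orbit_le n : wdist alpha (nu n) eta <= (r ^+ n)%:E * wdist alpha (nu 0%N) eta.
Proof.
elim: n => [|n IHn]; first by rewrite expr0 mul1e.
apply: le_trans (wdist_measure_eq alpha_gt0 (nu_step n) (measure_eq_sym eta_inv)) _.
apply: le_trans (P_contract _ _) _.
by rewrite exprS EFinM -muleA lee_pmul2l.
Qed.

Lemma sum_wdist_orbit_le t :
  \sum_(1 <= s < t.+1) wdist alpha (nu s) eta <=
  (2 * r / (1 - r) ^+ 2)%:E * wdist alpha (nu 1%N) (nu 0%N).
Proof.
have r1 : (0 < 1 - r)%R by rewrite subr_gt0.
have D0 nu1 nu2 : 0 <= wdist alpha nu1 nu2 by exact: wdist_ge0.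
apply: (@le_trans _ _ ((r / (1 - r))%:E * wdist alpha (nu 0%N) eta)).
  apply: (@le_trans _ _ (\sum_(1 <= s < t.+1) (r ^+ s)%:E * wdist alpha (nu 0%N) eta)).
    by apply: lee_sum => s _; exact: wdist_orbit_le.
  rewrite -ge0_sume_distrl; last first.
    by move=> s _; rewrite lee_fin exprn_ge0// ltW.
  rewrite sumEFin lee_wpmul2r// lee_fin.
  rewrite -add1n (geometric_partial_tail t 1 r) expr1.
  by apply: geometric_le_lim; rewrite ?ltW ?ger0_norm// ?ltW.
have dle : wdist alpha (nu 0%N) eta <=
    (1 - r)^-1%:E * wdist alpha (nu 1%N) (nu 0%N).
  apply: le_trans (wdist_invariant_le alpha_gt0 r_gt0 r_lt1 P_contract _ eta_inv) _.
  rewrite lee_pmul2l ?lte_fin ?invr_gt0//; apply: wdist_measure_eq => //.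
  exact: measure_eq_sym.
apply: (@le_trans _ _ ((r / (1 - r))%:E * ((1 - r)^-1%:E * wdist alpha (nu 1%N) (nu 0%N)))).
  by rewrite lee_pmul2l ?lte_fin ?divr_gt0.
rewrite muleA -EFinM lee_wpmul2r// lee_fin.
have -> : (r / (1 - r) * (1 - r)^-1 = r / (1 - r) ^+ 2)%R by rewrite -mulrA -invfM.
rewrite ler_pM2r ?invr_gt0 ?exprn_gt0//.
by rewrite ler_peMl ?ler1n ?ltW.
Qed.

End orbit.

Theorem theorem5p8 (R : realType) (X : completeMetricType R)
  (Xsep : separable X)
  (m : nat) (f : 'I_m -> X -> X) (hf : forall j, lipschitz_map (f j))
  (mu : nat -> 'I_m -> R) (hmu : forall k, prob_vector (mu k))
  (e : R) (e_ge0 : (0 <= e)%R)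
  (mu_drift : forall k : nat, (0 < k)%N ->
     (\sum_(j < m) `|mu k j - mu k.+1 j| <= e)%R)
  (alpha : R) (alpha_gt0 : (0 < alpha)%R) (alpha_le1 : (alpha <= 1)%R)
  (r : R) (r_gt0 : (0 < r)%R) (r_lt1 : (r < 1)%R)
  (P_contract : forall (k : nat) (nu1 nu2 : borel_prob X),
     wdist alpha (markov_dual hf (hmu k) nu1) (markov_dual hf (hmu k) nu2)
       <= r%:E * wdist alpha nu1 nu2)
  (nustar : nat -> borel_prob X)
  (nustar_inv : forall k : nat,
     measure_eq (markov_dual hf (hmu k) (nustar k)) (nustar k))
  (nu : nat -> nat -> borel_prob X)
  (nu_step : forall k i : nat,
     measure_eq (nu k i.+1) (markov_dual hf (hmu k) (nu k i)))
  (t : nat) (t_ge1 : (1 <= t)%N)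
  (G : set (borel_prob X -> borel_prob X))
  (c : \bar R) :
  regret c alpha t G nu nustar <=
    \sum_(0 <= k <oo)
      (2 * r / (1 - r) ^+ 2)%:E * wdist alpha (nu k 1%N) (nu k 0%N).
Proof.
have u_ge0 (g : borel_prob X -> borel_prob X) k :
    0 <= \sum_(1 <= s < t.+1) wdist alpha (g (nu k s)) (nustar k).
  by apply: sume_ge0 => s _; exact: wdist_ge0.
have bound : \sum_(0 <= k <oo) \sum_(1 <= s < t.+1) wdist alpha (nu k s) (nustar k)
    <= \sum_(0 <= k <oo)
        (2 * r / (1 - r) ^+ 2)%:E * wdist alpha (nu k 1%N) (nu k 0%N).
  apply: lee_nneseries => [k _ _|k _]; first exact: (u_ge0 id).
  exact: (sum_wdist_orbit_le alpha_gt0 r_gt0 r_lt1 (P_contract k)).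
apply: ub_ereal_sup => _ [g _ <-]; rewrite /esub.
(* whatever value is given to an undefined difference, the right-hand side is
   then infinite *)
case: ifPn => [/andP[/eqP Ey _]|_].
  by move: bound; rewrite Ey leye_eq => /eqP ->; exact: leey.
apply: le_trans bound; rewrite -[leRHS]adde0 leeD// oppe_le0.
by apply: nneseries_ge0 => k _ _; exact: u_ge0.
Qed.
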